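(* Let $N=\{1,\dots,n\}$ be a finite set of agents, let $S_i=[\underline{s}_i,\overline{s}_i]\subset\mathbb{R}$ be the signal space of agent $i$, and for each $i\in N$ let $v_i:\prod_{j\in N}S_j\to\mathbb{R}$ be a valuation function such that, for every $s_{-i}$, the map $s_i\mapsto v_i(s_i,s_{-i})$ is convex, continuous and non-decreasing on $S_i$. Let $q=(q_i)_{i\in N}$, $q_i:\prod_{j\in N}S_j\to[0,1]$, be an allocation rule. Then $q$ is ex-post implementable if and only if $q$ is eventually monotone.
   Context: For a signal profile $s=(s_1,\dots,s_n)$, $s_{-i}$ denotes the signals of the agents other than $i$, and $(s_i,s_{-i})=s$. For each $i$ and $s_{-i}$ define $$\ell_{v_i}(s_{-i}):=\sup\{s_i\in S_i:\ v_i(s_i,s_{-i})=v_i(\underline{s}_i,s_{-i})\}.$$ An allocation rule is a tuple $q=(q_i)_{i\in N}$ with $q_i:\prod_j S_j\to[0,1]$; a payment rule is a tuple $p=(p_i)_{i\in N}$ with $p_i:\prod_j S_j\to\mathbb{R}$. Given $(q,p)$, the net payoff of agent $i$ is $u_i(s_i,s_{-i})=q_i(s_i,s_{-i})v_i(s_i,s_{-i})-p_i(s_i,s_{-i})$. Ex-post implementable: $q$ is ex-post implementable if there exists a payment rule $p$ such that for all $i$, all $s_{-i}$ and all $s_i,s_i'\in S_i$, $$u_i(s_i,s_{-i})\ \ge\ u_i(s_i',s_{-i})+[v_i(s_i,s_{-i})-v_i(s_i',s_{-i})]\,q_i(s_i',s_{-i}).$$ Eventually monotone: $q$ is eventually monotone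 if for all $i$, all $s_{-i}$, and all $s_i,s_i'\in S_i$ with $s_i>s_i'$ and $s_i>\ell_{v_i}(s_{-i})$, we have $q_i(s_i,s_{-i})\ge q_i(s_i',s_{-i})$. *)

(* Defs.v *)
From HB Require Import structures.
From mathcomp Require Import all_boot all_order all_algebra.
From mathcomp Require Import all_classical all_reals all_analysis.

Set Implicit Arguments.
Unset Strict Implicit.
Unset Printing Implicit Defensive.

Import Order.TTheory GRing.Theory Num.Theory.
Import numFieldNormedType.Exports.

Local Open Scope classical_set_scope.
Local Open Scope ring_scope.

(** Agents are the elements of ['I_n] and agent [i] has signal space
    [`[lo i, hi i]].  Profiles are functions ['I_n -> R] and profile-dependent
    data (valuations, allocations, payments) are total on ['I_n -> R]; every
    hypothesis and every property below only concerns their values on the box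
    [signal_profiles lo hi].  A profile [s_{-i}] of the other agents is given
    by a full profile [s] whose [i]-th coordinate is irrelevant, since it gets
    overwritten: [(x, s_{-i})] is [with_signal s i x]. *)

Definition signal_profiles (R : realType) (n : nat) (lo hi : 'I_n -> R) :
    set ('I_n -> R) :=
  [set s | forall i, s i \in `[lo i, hi i]].

Definition with_signal (R : realType) (n : nat) (s : 'I_n -> R) (i : 'I_n)
    (x : R) : 'I_n -> R :=
  @eqtype.dfwith 'I_n (fun=> R) s i x.

Definition convex_continuous_nondecreasing (R : realType) (n : nat)
    (lo hi : 'I_n -> R) (v : 'I_n -> ('I_n -> R) -> R) : Prop :=
  forall (i : 'I_n) (s : 'I_n -> R), signal_profiles lo hi s ->
    let f := fun x : R => v i (with_signal s i x) in
    [/\ convex_function (`[lo i, hi i] : set R^o) f,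
        {within `[lo i, hi i], continuous f} &
        {in `[lo i, hi i] &, {homo f : x y / x <= y}}].

Definition allocation_rule (R : realType) (n : nat) (lo hi : 'I_n -> R)
    (q : 'I_n -> ('I_n -> R) -> R) : Prop :=
  forall (i : 'I_n) (s : 'I_n -> R), signal_profiles lo hi s ->
    0 <= q i s <= 1.

Definition net_payoff (R : realType) (n : nat)
    (v q p : 'I_n -> ('I_n -> R) -> R) (i : 'I_n) (s : 'I_n -> R) : R :=
  q i s * v i s - p i s.

Definition ex_post_implementable (R : realType) (n : nat)
    (lo hi : 'I_n -> R) (v q : 'I_n -> ('I_n -> R) -> R) : Prop :=
  exists p : 'I_n -> ('I_n -> R) -> R,
    forall (i : 'I_n) (s : 'I_n -> R), signal_profiles lo hi s ->
    forall x x' : R, x \in `[lo i, hi i] -> x' \in `[lo i, hi i] ->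
      net_payoff v q p i (with_signal s i x) >=
      net_payoff v q p i (with_signal s i x') +
      (v i (with_signal s i x) - v i (with_signal s i x')) *
        q i (with_signal s i x').

(** [ell_v_i(s_{-i})]; the set contains [lo i] and is bounded by [hi i] when
    [lo i <= hi i], so that [sup] is then the actual supremum. *)
Definition flat_end (R : realType) (n : nat) (lo hi : 'I_n -> R)
    (v : 'I_n -> ('I_n -> R) -> R) (i : 'I_n) (s : 'I_n -> R) : R :=
  sup [set x : R | x \in `[lo i, hi i] /\
         v i (with_signal s i x) = v i (with_signal s i (lo i))].

Definition eventually_monotone (R : realType) (n : nat)
    (lo hi : 'I_n -> R) (v q : 'I_n -> ('I_n -> R) -> R) : Prop :=
  forall (i : 'I_n) (s : 'I_n -> R), signal_profiles lo hi s ->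
  forall x x' : R, x \in `[lo i, hi i] -> x' \in `[lo i, hi i] ->
    x > x' -> x > flat_end lo hi v i s ->
    q i (with_signal s i x) >= q i (with_signal s i x').

(* Main.v *)
(** Fix an agent and the signals of the others.  Implementability asks for a
    utility [U] such that [U y + (f x - f y) * g y <= U x], where [f] is the
    valuation and [g] the allocation as functions of the own signal.  Adding the
    inequalities for [(x, y)] and [(y, x)] gives [0 <= (f x - f y) * (g x - g y)],
    and a convex nondecreasing [f] is strictly increasing beyond its flat part.
    Conversely, an eventually monotone [g] equals, beyond the flat part, [h \o f]
    for the nondecreasing [h w] = supremum of [g] over the signals of value at
    most [w], and [U] is the integral of [h] up to [f]: on the flat part only
    [g <= h \o f] holds, but there [f x - f y] is always nonnegative. *)
Require Import Defs.
From mathcomp Require Import all_boot all_order all_algebra.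
From mathcomp Require Import all_classical all_reals all_analysis.
From mathcomp Require Import lra.
Import Order.TTheory GRing.Theory Num.Theory.
Import numFieldNormedType.Exports.
Local Open Scope classical_set_scope.
Local Open Scope ring_scope.

(** Monotonicity gives measurability, and the endpoint values bound [h] on the segment. *)
Lemma nondecreasing_integrable_itv (R : realType) (h : R -> R) (a b : R) :
  nondecreasing_fun h ->
  (@lebesgue_measure R).-integrable [set` `[a, b]] (EFin \o h).
Proof.
move=> h_homo; apply: measurable_bounded_integrable => //.
- have := lebesgue_measure_itv `[a, b]; rewrite /= => ->.
  by case: ifP => _; rewrite ltry.
- exact: measurable_realfun.nondecreasing_measurable.
exists (`|h a| + `|h b|); split; first exact: num_real.
move=> M M_gt x /=; rewrite in_itv /= => /andP[ax xb].
move: (h_homo _ _ ax) (h_homo _ _ xb) M_gt.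
have := ler_norm (h b); have := ler_norm (- h a); rewrite normrN.
have := normr_ge0 (h a); have := normr_ge0 (h b).
rewrite ler_norml => *; apply/andP; split; lra.
Qed.

(** [F] is the integral of [h] from [c]: between [x] and [y] the integrand stays on one side of
    [h y], so [h y] is a subgradient at [y]. *)
Lemma nondecreasing_subgradient (R : realType) (h : R -> R) (c : R) :
  nondecreasing_fun h ->
  exists F : R -> R, forall x y, c <= x -> c <= y ->
    F y + (x - y) * h y <= F x.
Proof.
move=> h_homo.
pose F x : R := \int[lebesgue_measure]_(t in [set` `[c, x]]) h t.
have F_itv x y : c <= x -> x <= y ->
    F y - F x = \int[lebesgue_measure]_(t in [set` `]x, y]]) h t.
  move=> cx xy; apply: Rintegral_itvB; rewrite ?bnd_simp//.
  exact: nondecreasing_integrable_itv.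
have int_itv x y : (@lebesgue_measure R).-integrable [set` `]x, y]] (EFin \o h).
  apply: integrableS (nondecreasing_integrable_itv R h x y h_homo) => //.
  exact: subset_itv_oc_cc.
have cst_itv (k x y : R) :
    (@lebesgue_measure R).-integrable [set` `]x, y]] (EFin \o (fun=> k)).
  apply: integrableS (nondecreasing_integrable_itv R (fun=> k) x y _) => //.
  exact: subset_itv_oc_cc.
have int_cst (k x y : R) : x <= y ->
    \int[lebesgue_measure]_(t in [set` `]x, y]]) k = k * (y - x).
  rewrite le_eqVlt => /orP[/eqP->|xy].
    by rewrite set_itvoc0 ?Rintegral_set0 ?subrr ?mulr0.
  by rewrite Rintegral_cst//= lebesgue_measure_itv/= lte_fin xy.
exists F => x y cx cy; have [xy|yx] := leP x y.
- have : F y - F x <= h y * (y - x).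
    rewrite F_itv// -int_cst//; apply: le_Rintegral => // t /=.
    by rewrite in_itv/= => /andP[_]; exact: h_homo.
  lra.
- have : h y * (x - y) <= F x - F y.
    rewrite F_itv ?(ltW yx)// -int_cst ?(ltW yx)//.
    apply: le_Rintegral => // t /=.
    by rewrite in_itv/= => /andP[/ltW + _]; exact: h_homo.
  lra.
Qed.

(** Unless [x = a], [x] is a convex combination of [a] and [y] with weight [t > 0] on [a], and
    [f a < f y] pulls its value strictly below [f y]. *)
Lemma convex_homo_lt (R : realType) (f : R -> R) (a b : R) :
  convex_function (`[a, b]%classic : set R^o) f ->
  {in `[a, b] &, {homo f : x y / x <= y}} ->
  {in `[a, b] &, forall x y, x < y -> f a < f y -> f x < f y}.
Proof.
move=> f_conv f_homo x y x_ab y_ab xy fay.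
have := x_ab; rewrite in_itv /= => /andP[ax xb].
have [->//|xNa] := eqVneq x a.
have a_ab : a \in `[a, b] by rewrite in_itv/= lexx (le_trans ax).
have a_lt_x : a < x by rewrite lt_neqAle eq_sym xNa.
have ya : 0 < y - a by lra.
pose t := (y - x) / (y - a).
have t_gt0 : 0 < t by rewrite divr_gt0// subr_gt0.
have t_le1 : t <= 1 by rewrite ler_pdivrMr// mul1r; lra.
have := f_conv (Itv01 (ltW t_gt0) t_le1) a y.
rewrite !inE => /(_ a_ab y_ab); rewrite !convRE /= /unstable.onem.
rewrite [conv _ _ _](_ : _ = x); last first.
  rewrite -[LHS]/(t * a + (1 - t) * y).
  suff : t * (y - a) = y - x by lra.
  by rewrite /t divfK// gt_eqF.
move=> /le_lt_trans; apply.
have : t * f a < t * f y by rewrite ltr_pM2l.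
lra.
Qed.

(** Turns lying beyond the flat part into a condition on values of [f]. *)
Lemma sup_flat_lt (R : realType) (f : R -> R) (a b x : R) :
  {within `[a, b], continuous f} ->
  {in `[a, b] &, {homo f : x y / x <= y}} ->
  x \in `[a, b] ->
  (sup [set y | y \in `[a, b] /\ f y = f a] < x) = (f a < f x).
Proof.
move=> /subspace_continuousP f_cont f_homo x_ab.
set A := [set y | _].
have := x_ab; rewrite in_itv /= => /andP[ax xb].
have a_ab : a \in `[a, b] by rewrite in_itv/= lexx (le_trans ax).
have fax : f a <= f x by exact: f_homo.
have A_ub : has_ubound A by exists b => y [+ _]; rewrite in_itv /= => /andP[].
apply/idP/idP => [|fax_lt].
  apply: contraLR; rewrite -!leNgt => fxa.
  by apply: ub_le_sup => //; split=> //; apply/le_anti/andP.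
have A_lt y : A y -> y < x.
  move=> [y_ab fy]; rewrite ltNge; apply/negP => xy.
  by have := f_homo _ _ x_ab y_ab xy; rewrite fy leNgt fax_lt.
have A0 : A !=set0 by exists a.
rewrite lt_neqAle; apply/andP; split; last first.
  by apply: ge_sup => // y /A_lt/ltW.
apply/eqP => supx.
(* By continuity [f] exceeds [f a] near [x], yet every neighbourhood of the supremum meets [A]. *)
have := f_cont x x_ab => /cvgr_gt-/(_ _ fax_lt).
rewrite /prop_near1/= -supx => /(closure_sup A0 A_ub)[y [[y_ab fy]]].
by move=> /(_ y_ab); rewrite -[from_subspace _ f y]/(f y) fy ltxx.
Qed.

(** The last hypothesis is eventual monotonicity read on values of [f]; it forces [g] to agree at
    points of equal value above [f a]. *)
Lemma monotone_potential (R : realType) (f g : R -> R) (a b : R) :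
  a <= b ->
  {in `[a, b] &, {homo f : x y / x <= y}} ->
  {in `[a, b], forall x, g x <= 1} ->
  {in `[a, b] &, forall x y, f a < f y -> f x <= f y -> g x <= g y} ->
  exists U : R -> R,
    {in `[a, b] &, forall x y, U y + (f x - f y) * g y <= U x}.
Proof.
move=> ab f_homo g_le1 g_mono.
have a_ab : a \in `[a, b] by rewrite in_itv/= lexx.
have fa_le y : y \in `[a, b] -> f a <= f y.
  by move=> y_ab; apply: f_homo => //; move: y_ab; rewrite in_itv => /andP[].
(* [f] need not be injective where [f = f a], and [g] is not monotone there:
   taking suprema still gives a nondecreasing function [h] of the value. *)
pose G w := [set g y | y in [set y | y \in `[a, b] /\ f y <= Num.max w (f a)]].
(* The maximum with [f a] keeps [a] admissible for every [w], which makes [h] monotone on the whole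
   line. *)
have G0 w : G w !=set0 by exists (g a), a => //=; rewrite le_max lexx orbT.
have G_ub w : has_ubound (G w) by exists 1 => _ [y [y_ab _] <-]; exact: g_le1.
pose h w := sup (G w).
have h_homo : nondecreasing_fun h.
  move=> w w' ww'; apply: ge_sup => // _ [y [y_ab fy] <-].
  apply: ub_le_sup => //; exists y => //; split=> //.
  by apply: le_trans fy _; rewrite ge_max !le_max ww' lexx orbT.
have g_le_h y : y \in `[a, b] -> g y <= h (f y).
  by move=> y_ab; apply: ub_le_sup => //; exists y => //=; rewrite le_max lexx.
have [F F_sub] := nondecreasing_subgradient _ _ (f a) h_homo.
exists (F \o f) => x y x_ab y_ab /=.
apply: le_trans (F_sub _ _ (fa_le _ x_ab) (fa_le _ y_ab)); rewrite lerD2l.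
have [fay|fya] := ltP (f a) (f y).
  suff -> : h (f y) = g y by [].
  apply/le_anti/andP; split; last exact: g_le_h.
  apply: ge_sup => // _ [z [z_ab +] <-].
  by rewrite (max_idPl (ltW fay)); exact: g_mono.
have fxy : 0 <= f x - f y by rewrite subr_ge0 (le_trans fya)// fa_le.
by rewrite ler_wpM2l// g_le_h.
Qed.

Lemma with_signal_same {R : realType} {n : nat} (s : 'I_n -> R) (i : 'I_n) x :
  with_signal s i x i = x.
Proof. exact: eqtype.dfwith_in. Qed.

Lemma with_signalK {R : realType} {n : nat} (s : 'I_n -> R) (i : 'I_n) x y :
  with_signal (with_signal s i x) i y = with_signal s i y.
Proof.
apply/funext => j; have [<-|ij] := eqVneq i j; first by rewrite !with_signal_same.
by rewrite /with_signal !eqtype.dfwith_out.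
Qed.

Lemma with_signal_profile {R : realType} {n : nat} (lo hi s : 'I_n -> R)
    (i : 'I_n) (x : R) :
  signal_profiles lo hi s -> x \in `[lo i, hi i] ->
  signal_profiles lo hi (with_signal s i x).
Proof.
move=> s_box x_box j; rewrite /with_signal.
by case: eqtype.dfwithP => // *; exact: s_box.
Qed.

Theorem theorem1 (R : realType) (n : nat) (lo hi : 'I_n -> R)
    (lo_le_hi : forall i : 'I_n, lo i <= hi i)
    (v : 'I_n -> ('I_n -> R) -> R)
    (v_valuation : convex_continuous_nondecreasing lo hi v)
    (q : 'I_n -> ('I_n -> R) -> R)
    (q_allocation : allocation_rule lo hi q) :
  ex_post_implementable lo hi v q <-> eventually_monotone lo hi v q.
Proof.
split=> [[p p_impl] i s s_box x y x_box y_box yx|q_mono].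
  have [v_conv v_cont v_homo] := v_valuation i s s_box.
  rewrite /flat_end (sup_flat_lt _ _ _ _ _ v_cont v_homo x_box) => v_lt.
  have := convex_homo_lt _ _ _ _ v_conv v_homo _ _ y_box x_box yx v_lt.
  have := p_impl i s s_box _ _ y_box x_box.
  have := p_impl i s s_box _ _ x_box y_box.
  rewrite -subr_gt0 => ? ? v_gt.
  rewrite -subr_ge0 -(pmulr_rge0 _ v_gt); lra.
(* Agent and profile form one index, with the box condition under the existential, so that [choice]
   yields all potentials at once. *)
have potential (k : 'I_n * ('I_n -> R)) : exists U : R -> R,
    signal_profiles lo hi k.2 -> {in `[lo k.1, hi k.1] &, forall x y,
      U y + (v k.1 (with_signal k.2 k.1 x) -
             v k.1 (with_signal k.2 k.1 y)) *
        q k.1 (with_signal k.2 k.1 y) <= U x}.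
  case: k => i s /=.
  have [s_box|] := pselect (signal_profiles lo hi s); last by exists id.
  have [v_conv v_cont v_homo] := v_valuation i s s_box.
  have [||U HU] := monotone_potential _ _
    (fun x => q i (with_signal s i x)) _ _ (lo_le_hi i) v_homo; last by exists U.
    move=> x x_box.
    by have /andP[] := q_allocation i _ (with_signal_profile _ _ _ _ _ s_box x_box).
  (* If [y < x], strict growth beyond the flat part contradicts [v_le]; if [x < y], eventual
     monotonicity applies. *)
  move=> x y x_box y_box v_lt v_le; have [yx|xy|->//] := ltgtP y x.
    have := v_homo _ _ y_box x_box (ltW yx) => v_ge.
    have v_lt' := lt_le_trans v_lt v_ge.
    have := convex_homo_lt _ _ _ _ v_conv v_homo _ _ y_box x_box yx v_lt'.
    by rewrite ltNge v_le.
  by apply: q_mono => //; rewrite /flat_end (sup_flat_lt _ _ _ _ _ v_cont v_homo).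
have [U HU] := choice potential.
(* The potential must not depend on the signal of [i], which is therefore
   reset to [lo i]. *)
exists (fun i s => q i s * v i s - U (i, with_signal s i (lo i)) (s i)).
move=> i s s_box x y x_box y_box.
have lo_box : lo i \in `[lo i, hi i] by rewrite in_itv/= lexx lo_le_hi.
have := HU (i, with_signal s i (lo i))
  (with_signal_profile _ _ _ _ _ s_box lo_box) x y x_box y_box.
(* The payment makes the net payoff equal to [U], so the potential inequality is the claim. *)
rewrite /net_payoff /= !with_signalK !with_signal_same; lra.
Qed.
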